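(* Let $\alpha\in\mathbb{R}\setminus\mathbb{Q}$. Then $$\limsup_{n\to\infty}\frac{-\log\|T_\alpha^n(x)\|_{\mathbb{Z}}}{\log n} = 1$$ for almost every $x\in\mathbb{T}^1$ (with respect to Haar measure).
   Context: $\mathbb{T}^1=\mathbb{R}/\mathbb{Z}$ with its probability Haar measure, $T_\alpha:\mathbb{T}^1\to\mathbb{T}^1$ is the rotation $T_\alpha(x)=x+\alpha$, and for $y\in\mathbb{T}^1$ (represented by a real number $y$), $\|y\|_{\mathbb{Z}} := \inf_{p\in\mathbb{Z}}|y-p|$. *)

(* Defs.v *)
From HB Require Import structures.
From mathcomp Require Import all_boot all_order all_algebra.
From mathcomp Require Import all_classical all_reals all_analysis.
From mathcomp Require Import measurable_realfun.

Set Implicit Arguments.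
Unset Strict Implicit.
Unset Printing Implicit Defensive.

Import Order.TTheory GRing.Theory Num.Theory.
Import numFieldNormedType.Exports.

Local Open Scope classical_set_scope.
Local Open Scope ring_scope.
Local Open Scope quotient_scope.


Definition Zsubgroup (R : realType) : zmodClosed R :=
  GRing.ZmodClosed.clone R (@Num.int_num_subdef R) _.

(* The quotient group R/Z, with the Borel sigma-algebra of its quotient
   topology. *)
Definition torus (R : realType) : Type :=
  quotient_topology (Quotient.quot (Zsubgroup R)).

Section torus_structures.
Context {R : realType}.

HB.instance Definition _ := Topological.on (torus R).
HB.instance Definition _ := Quotient.on (torus R).
HB.instance Definition _ :=
  GRing.Zmodule.copy (torus R) (Quotient.quot (Zsubgroup R)).
HB.instance Definition _ := isPointed.Build (torus R) 0.

HB.instance Definition _ :=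
  @isMeasurable.Build (sigma_display (@open (torus R))) (torus R)
    <<s @open (torus R) >> (@sigma_algebra0 _ setT _)
    (@sigma_algebraC _ _) (@sigma_algebra_bigcup _ setT _).

Definition torus_pi (x : R) : torus R := \pi_(torus R) x.

Lemma torus_piD : {morph torus_pi : x y / x + y}.
Proof. exact: Quotient.pi_add. Qed.

Lemma torus_pi_eq (x y : R) :
  torus_pi x = torus_pi y <-> x - y \is a Num.int.
Proof.
have E : (x - y \is a Num.int) = (x == y %[mod Quotient.quot (Zsubgroup R)]).
  exact: (Quotient.idealrBE (Zsubgroup R)).
by rewrite E; split=> [xy|/eqP]//; apply/eqP.
Qed.

Lemma torus_piDint (x : R) (m : int) : torus_pi (x + m%:~R) = torus_pi x.
Proof. by apply/torus_pi_eq; rewrite addrAC subrr add0r. Qed.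

Lemma measurable_torus_pi : measurable_fun setT torus_pi.
Proof.
apply: (measurability (@open (torus R))) => //.
move=> _ [U oU <-]; rewrite setTI; exact: open_measurable.
Qed.

End torus_structures.

Section haar.
Context {R : realType}.

(* A set of circle points gets the Lebesgue measure of its representatives in
   [0, 1[; haar_translate and the probability instance below identify this as
   the normalized Haar measure. *)
Definition haar : set (torus R) -> \bar R :=
  pushforward
    (mrestr (@lebesgue_measure R) (measurable_itv `[0%R, 1%R[)) torus_pi.

Lemma haarE (A : set (torus R)) :
  haar A = lebesgue_measure (torus_pi @^-1` A `&` `[0%R, 1%R[).
Proof. by []. Qed.

Let haar0 : haar set0 = 0%E.
Proof. by rewrite haarE preimage_set0 set0I measure0. Qed.

Let haar_ge0 A : (0 <= haar A)%E.
Proof. by rewrite haarE; exact: measure_ge0. Qed.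

Let haar_sigma_additive : semi_sigma_additive haar.
Proof.
rewrite /haar; apply: measure_semi_sigma_additive.
exact: measurable_torus_pi.
Qed.

HB.instance Definition _ := isMeasure.Build _ _ _ haar
  haar0 haar_ge0 haar_sigma_additive.

Let haar_setT : haar setT = 1%E.
Proof.
by rewrite haarE preimage_setT setTI lebesgue_measure_itv/= lte_fin ltr01 sube0.
Qed.

HB.instance Definition _ := Measure_isProbability.Build _ _ _ haar haar_setT.

Let lebesgue_shift (a : R) (A : set R) : measurable A ->
  lebesgue_measure ((fun x => x + a) @^-1` A) = lebesgue_measure A.
Proof.
move=> mA.
transitivity (pushforward lebesgue_measure
  ((fun x => x + a) : R -> measurableTypeR R) A) => //.
apply/esym/lebesgue_measure_unique => //=.
  exact: measurable_funD.
move=> _ _ [[b c]] _ <-.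
rewrite /pushforward (_ : _ @^-1` _ = `]b - a, c - a]%classic); last first.
  by apply/seteqP; split => x /=; rewrite !in_itv/= ltrBlDr lerBrDr.
by rewrite !lebesgue_measure_itv/= !lte_fin ltrD2r -!EFinB opprB addrA subrK.
Qed.

Let haar_fund (P : set R) (t : R) : measurable P ->
  (forall x, P (x + 1) <-> P x) -> 0 <= t <= 1 ->
  lebesgue_measure (P `&` `[t, t + 1[) = lebesgue_measure (P `&` `[0, 1[).
Proof.
move=> mP P1 /andP[t0 t1].
have split3 (a b c : R) : a <= b -> b <= c ->
    lebesgue_measure (P `&` `[a, c[) =
    (lebesgue_measure (P `&` `[a, b[) + lebesgue_measure (P `&` `[b, c[))%E.
  move=> ab bc; rewrite -measureU.
  - congr lebesgue_measure; rewrite -setIUr; congr (_ `&` _).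
    apply/seteqP; split => x /=; rewrite !in_itv/=.
      by move=> /andP[ax xc]; case: (ltP x b) => xb; [left|right]; apply/andP.
    move=> [] /andP[h1 h2]; apply/andP; split => //.
      exact: lt_le_trans bc.
    exact: le_trans h1.
  - by apply: measurableI.
  - by apply: measurableI.
  - apply/seteqP; split => // x /= [[_]]; rewrite !in_itv/= => /andP[_ xb].
    by move=> [_ /andP[bx _]]; move: (lt_le_trans xb bx); rewrite ltxx.
rewrite (split3 t 1) ?lerDr// (split3 0 t 1)// addeC; congr (_ + _)%E.
rewrite -(@lebesgue_shift 1); last exact: measurableI.
congr lebesgue_measure; apply/seteqP; split => x /= [Px];
  rewrite !in_itv/= => h; split.
- exact/P1.
- by move: h; rewrite lerDr ltrD2r.
- exact/P1.
- by move: h; rewrite lerDr ltrD2r.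
Qed.

Lemma haar_translate (c : torus R) (A : set (torus R)) : measurable A ->
  haar ((fun x => x + c) @^-1` A) = haar A.
Proof.
move=> mA; rewrite !haarE.
have mP : measurable (torus_pi @^-1` A).
  by rewrite -[X in measurable X]setTI; exact: measurable_torus_pi.
pose t := repr c - (Num.floor (repr c))%:~R.
have ct : c = torus_pi t.
  by rewrite /t -intrN torus_piDint /torus_pi reprK.
have /andP[t0 t1] : 0 <= t <= 1.
  rewrite /t subr_ge0 ge_floor/= lerBlDl -[1]/(1%:~R) -intrD ltW// floorD1_gt//.
transitivity (lebesgue_measure (torus_pi @^-1` A `&` `[t, t + 1[)).
  rewrite -(@lebesgue_shift t (_ `&` `[t, _[)); last exact: measurableI.
  congr lebesgue_measure; apply/seteqP; split => x /= [Px];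
    rewrite !in_itv/= => h; split.
  - by rewrite torus_piD -ct.
  - by rewrite lerDr addrC ltrD2l.
  - by rewrite ct -torus_piD.
  - by move: h; rewrite lerDr addrC ltrD2l.
apply: haar_fund => //; last by rewrite t0 t1.
by move=> x; rewrite /preimage/= -[1]/(1%:~R) torus_piDint.
Qed.

End haar.

Section rotation.
Context {R : realType}.

Definition dist_int (y : R) : R := inf [set `|y - p%:~R| | p in [set: int]].

Lemma dist_intDint (y : R) (m : int) : dist_int (y + m%:~R) = dist_int y.
Proof.
congr inf; apply/seteqP; split => _ /= [p _ <-].
  by exists (p - m) => //; rewrite intrB opprB addrA.
by exists (p + m) => //; rewrite intrD opprD addrACA subrr addr0.
Qed.

(* torus_normE: the value does not depend on the chosen representative. *)
Definition torus_norm (y : torus R) : R := dist_int (repr y).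

Lemma torus_normE (y : R) : torus_norm (torus_pi y) = dist_int y.
Proof.
have /intrP[m ym] : repr (torus_pi y) - y \is a Num.int.
  by apply/torus_pi_eq; rewrite /torus_pi reprK.
by rewrite /torus_norm -(subrK y (repr _)) ym addrC dist_intDint.
Qed.

Definition rotation (alpha : R) (x : torus R) : torus R := x + torus_pi alpha.

End rotation.

(* Main.v *)
(* Upper bound: rotations preserve Haar measure, so the points x with
   ||x + n alpha|| < r^k for some n in the dyadic block [2^k, 2^(k+1)[ form a
   set of measure at most 2 (2r)^k; for r < 1/2 Borel-Cantelli bounds the limsup
   by -log r / log 2, and r tends to 1/2.
   Lower bound, valid for every x: if p/q is a reduced Dirichlet approximation
   of alpha, the points n alpha with q <= n < 2q are within O(1/q) of the
   points of (1/q)Z/Z, each of which is hit, so ||x + n alpha|| <= 6/n for one of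
   these n. *)
Require Import Defs.
From HB Require Import structures.
From mathcomp Require Import all_boot all_order all_algebra.
From mathcomp Require Import all_classical all_reals all_analysis.
From mathcomp Require Import ring lra.

Import Order.TTheory GRing.Theory Num.Theory.
Import numFieldNormedType.Exports.

Local Open Scope classical_set_scope.
Local Open Scope ring_scope.

(** * Reduced Dirichlet approximations with large denominator *)

Lemma floor_frac_itv (R : realType) (x : R) :
  0 <= x - (Num.floor x)%:~R < 1.
Proof.
have := floor_itv x; rewrite intrD => /andP[h1 h2]; apply/andP; split; lra.
Qed.

(** Pigeonhole: the [Q + 1] fractional parts [fr i], [i <= Q], lie in [Q] boxes of length [1 / Q],
    the box of [fr i] having index [f i]. Two in one box give [q] as the difference of their
    indices. *)
Lemma dirichlet_approx (R : realType) (x : R) (Q : nat) : (0 < Q)%N ->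
  exists (q : nat) (p : int), [/\ (0 < q)%N, (q <= Q)%N
    & `|q%:R * x - p%:~R| < Q%:R^-1].
Proof.
move=> Q0; apply: contrapT => noq.
have QR0 : 0 < Q%:R :> R by rewrite ltr0n.
pose fr (i : nat) : R := i%:R * x - (Num.floor (i%:R * x))%:~R.
pose f (i : nat) := Num.truncn (Q%:R * fr i).
have fr01 i : 0 <= fr i < 1 by exact: floor_frac_itv.
have f_itv i : (f i)%:R <= Q%:R * fr i < (f i)%:R + 1.
  have /andP[fr0 _] := fr01 i.
  by have := @truncn_itv _ (Q%:R * fr i) (mulr_ge0 (ltW QR0) fr0); rewrite -natr1.
have far (i j : nat) : (i < j <= Q)%N -> f i <> f j.
  move=> /andP[ij jQ] fij; apply: noq.
  exists (j - i)%N, (Num.floor (j%:R * x) - Num.floor (i%:R * x)).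
  split; [by rewrite subn_gt0|exact: leq_trans (leq_subr _ _) jQ|].
  have -> : (j - i)%:R * x - (Num.floor (j%:R * x) - Num.floor (i%:R * x))%:~R
      = fr j - fr i.
    by rewrite natrB ?(ltnW ij)// intrB /fr; ring.
  rewrite -[_^-1]mul1r ltr_pdivlMr// -[X in _ * X]gtr0_norm// -normrM mulrC.
  have := f_itv i; have := f_itv j; rewrite fij => /andP[? ?] /andP[? ?].
  by rewrite mulrBr ltr_norml; apply/andP; split; lra.
suff : (Q.+1 <= Q)%N by rewrite ltnn.
apply: (@pigeonhole _ _ f).
  move=> i j; rewrite !inE/= => iQ jQ fij.
  have [ij|ji|//] := ltngtP i j.
  - by case: (far i j); rewrite ?ij.
  - by case: (far j i); rewrite ?ji.
move=> _ [i iQ <-] /=; rewrite -(ltr_nat R).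
have /andP[h _] := f_itv i; apply: le_lt_trans h _.
by have /andP[_ ?] := fr01 i; rewrite -[ltRHS]mulr1 ltr_pM2l.
Qed.

Lemma irrational_mul_neq_int (R : realType) (alpha : R) (q : nat) (p : int) :
  irrational alpha -> (0 < q)%N -> q%:R * alpha != p%:~R.
Proof.
move=> irr q0; apply/eqP => qp; apply: irr; apply/rationalP; exists p, q.
by rewrite -qp mulrAC divff ?mul1r// pnatr_eq0 -lt0n.
Qed.

(** Used to exclude small denominators: an approximation with error below [delta] must have
    denominator above [N]. *)
Lemma irrational_dist_int_bound (R : realType) (alpha : R) (N : nat) :
  irrational alpha -> exists2 delta : R, 0 < delta &
    forall (q : nat) (p : int), (0 < q <= N)%N ->
      delta <= `|q%:R * alpha - p%:~R|.
Proof.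
move=> irr; elim: N => [|N [delta d0 IH]].
  by exists 1 => // -[].
set z : R := N.+1%:R * alpha.
have zn p : z != p%:~R by exact: irrational_mul_neq_int.
have /andP[z0 z1] := floor_frac_itv _ z.
have {}z0 : 0 < z - (Num.floor z)%:~R by rewrite lt_neqAle z0 eq_sym subr_eq0 zn.
(* The nearest integer to [z] is its floor or the next integer, so the new minimum is over the two
   gaps, both positive by irrationality. *)
exists (Num.min delta (Num.min (z - (Num.floor z)%:~R)
                               (1 - (z - (Num.floor z)%:~R)))).
  by rewrite !lt_min d0 z0/= subr_gt0.
move=> q p /andP[q0]; rewrite leq_eqVlt => /predU1P[->|qN]; last first.
  by rewrite ge_min IH// q0.
rewrite -/z !ge_min; apply/orP; right; apply/orP.
have [pz|pz] := leP p (Num.floor z).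
  left; have := ler_norm (z - p%:~R).
  by move: pz; rewrite -(ler_int R) => ? ?; lra.
right; rewrite distrC; have := ler_norm (p%:~R - z).
by move: pz; rewrite -lezD1 -(ler_int R) intrD => ? ?; lra.
Qed.

(** Dividing a Dirichlet approximation by its gcd only shrinks the error and the denominator. The
    error stays below [1 / Q < delta], which rules out [q' <= N]. *)
Lemma dirichlet_coprime (R : realType) (alpha : R) (N : nat) :
  irrational alpha -> exists (q : nat) (p : int), [/\ (N < q)%N, coprimez p q
    & `|q%:R * alpha - p%:~R| < q%:R^-1].
Proof.
move=> irr; have [delta d0 Hd] := @irrational_dist_int_bound _ alpha N irr.
pose Q := (Num.truncn delta^-1).+1.
have Q0 : 0 < Q%:R :> R by rewrite ltr0n.
have dQ : Q%:R^-1 < delta.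
  by rewrite invf_plt ?posrE// /Q truncnS_gt.
have [q [p [q0 qQ qp]]] := @dirichlet_approx _ alpha Q isT.
pose g := gcdz p q.
have g0 : (0 < `|g|)%N 
  by rewrite /g absz_gt0 gcdz_eq0 negb_and eqz_nat -lt0n q0 orbT.
have gE : g = `|g|%N by rewrite gez0_abs.
have gq : (g %| q%:Z)%Z by exact: dvdz_gcdr.
have [q' q'E] : exists q' : nat, q = (q' * `|g|)%N.
  by exists (q %/ `|g|)%N; rewrite divnK// -[q in (_ %| q)%N]absz_nat -dvdzE.
have [p' p'E] : exists p' : int, p = p' * g.
  by exists ((p %/ g)%Z); rewrite divzK// dvdz_gcdl.
have q'0 : (0 < q')%N by move: q0; rewrite q'E muln_gt0 => /andP[].
have q'q : (q' <= q)%N by rewrite q'E leq_pmulr.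
have pqR : q%:R * alpha - p%:~R = `|g|%:R * (q'%:R * alpha - p'%:~R) :> R.
  by rewrite p'E gE q'E natrM intrM -pmulrn; ring.
have q'p' : `|q'%:R * alpha - p'%:~R| < Q%:R^-1.
  apply: le_lt_trans qp; rewrite pqR normrM normr_nat ler_peMl//.
  by rewrite ler1n.
exists q', p'; split.
- rewrite ltnNge; apply/negP => q'N.
  have := Hd q' p'; rewrite q'0 q'N => /(_ isT).
  by move=> /(le_lt_trans)/(_ q'p')/lt_trans/(_ dQ); rewrite ltxx.
(* Coprimality: [g] is the gcd of [p' * g] and [q' * g], and the common factor cancels. *)
- have gn0 : g != 0 by rewrite -absz_gt0.
  have qE : q%:Z = q'%:Z * g by rewrite gE -PoszM -q'E.
  apply/eqP/(mulIf gn0); rewrite mul1r -{2}[g]/(gcdz p q) qE p'E.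
  by rewrite {1}gE mulz_gcdl.
- apply: lt_le_trans q'p' _; rewrite lef_pV2 ?posrE ?ltr0n// ler_nat.
  exact: leq_trans q'q qQ.
Qed.

(** * Distance to the integers and inhomogeneous approximation *)

Lemma dist_int_le (R : realType) (y : R) (p : int) : dist_int y <= `|y - p%:~R|.
Proof. by apply: ge_inf; [exists 0 => _ [k _ <-]|exists p]. Qed.

Lemma dist_int_lt (R : realType) (y r : R) :
  dist_int y < r <-> exists p : int, `|y - p%:~R| < r.
Proof.
split=> [yr|[p]]; last exact/le_lt_trans/dist_int_le.
have hi : has_inf [set `|y - p%:~R| | p in [set: int]].
  by split; [exists `|y - 0%:~R|, 0|exists 0 => _ [k _ <-]].
have yr0 : 0 < r - dist_int y by rewrite subr_gt0.
have [_ [p _ <-] pr] := inf_adherent yr0 hi.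
by exists p; move: pr; rewrite -/(dist_int y) addrCA subrr addr0.
Qed.

(* [n] is the solution in [[q, 2q[] of [n p = - floor (q y)] modulo [q], where
   [p / q] is a reduced Dirichlet approximation of [alpha]. *)
Lemma inhomogeneous_approx (R : realType) (alpha y : R) (N : nat) :
  irrational alpha ->
  exists n : nat, (N < n)%N /\ dist_int (n%:R * alpha + y) <= 6 / n%:R.
Proof.
move=> irr; have [q [p [Nq pq qp]]] := @dirichlet_coprime _ alpha N irr.
have q0 : (0 < q)%N by exact: leq_ltn_trans Nq.
have qR0 : 0 < q%:R :> R by rewrite ltr0n.
have [u [v uv]] := Bezoutz p q.
pose m := - Num.floor (q%:R * y).
pose t := ((m * u)%R %% q)%Z.
have qZ : q%:Z != 0 by rewrite eqz_nat -lt0n.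
have t0 : 0 <= t by rewrite modz_ge0.
have tq : t < q by rewrite ltz_mod.
pose n := (q + `|t|)%N.
have nZ : n%:Z = q%:Z + t by rewrite /n PoszD gez0_abs.
have [k kE] : exists k : int, n%:Z * p - m = q%:Z * k.
  have := divz_eq (m * u) q; rewrite -/t; set D := (_ %/ _)%Z => tE.
  (* Substitute [t = m * u - D * q] and the Bezout relation [u * p = 1 - v * q] into
     [(q + t) * p - m]. *)
  exists (p - D * p - m * v); rewrite nZ.
  move/eqP: pq uv => -> uv.
  have -> : t = m * u - D * q by rewrite tE addrAC subrr add0r.
  rewrite -[X in _ - X]mulr1 -uv; ring.
have nq : (q <= n < 2 * q)%N.
  by rewrite /n leq_addr/= mul2n -addnn ltn_add2l -ltz_nat gez0_abs.
have /andP[qn n2q] := nq.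
have n0 : (0 < n)%N by exact: leq_trans qn.
exists n; split; first exact: leq_trans qn.
apply: le_trans (@dist_int_le _ _ k) _.
have kR : n%:R * p%:~R + (Num.floor (q%:R * y))%:~R = q%:R * k%:~R :> R.
  move/(congr1 (intr : int -> R)): kE.
  by rewrite /m opprK intrD !intrM -!pmulrn.
have fl := floor_frac_itv _ (q%:R * y).
rewrite ler_pdivlMr ?ltr0n//.
have nR : 0 < (n%:R : R) <= 2 * q%:R by rewrite ltr0n n0 -natrM ler_nat ltnW.
set e : R := _ - k%:~R.
(* The Dirichlet error contributes at most [2], since [n <= 2 * q], and the fractional part of
   [q * y] at most [1]. Using [n <= 2 * q] once more turns [3] into [6]. *)
have qe : `|q%:R * e| <= 3.
  have -> : q%:R * e = n%:R * (q%:R * alpha - p%:~R) +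
      (q%:R * y - (Num.floor (q%:R * y))%:~R).
    rewrite /e mulrBr -kR; ring.
  apply: le_trans (ler_normD _ _) _.
  rewrite -[3]/(2 + 1)%:R natrD lerD//; last first.
    by case/andP: fl => f0 f1; rewrite ger0_norm// ltW.
  rewrite normrM normr_nat; case/andP: nR => nR0 nR2.
  apply: le_trans (ler_pM _ _ nR2 (ltW qp)) _ => //.
  by rewrite -mulrA mulfV ?mulr1// gt_eqF.
apply: le_trans (_ : `|e| * (2 * q%:R) <= _).
  by rewrite ler_wpM2l//; case/andP: nR.
rewrite normrM normr_nat in qe; lra.
Qed.

(** * Haar measure of the shrinking targets and Borel-Cantelli *)

Lemma iter_rotation (R : realType) (alpha : R) (n : nat) (x : torus R) :
  iter n (rotation alpha) x = x + torus_pi (n%:R * alpha).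
Proof.
have pi0 : torus_pi 0 = 0 :> torus R.
  by apply: (addrI (torus_pi 0)); rewrite -torus_piD !addr0.
elim: n => [|n IH] /=; first by rewrite mul0r pi0 addr0.
by rewrite IH /rotation -addrA -torus_piD -natr1 mulrDl mul1r.
Qed.

Lemma measurable_rotation_lt (R : realType) (alpha r : R) (n : nat) :
  measurable [set x : torus R | torus_norm (iter n (rotation alpha) x) < r].
Proof.
apply: sub_sigma_algebra.
(* Openness in the quotient topology is by definition openness of the preimage in the line, here a
   union of balls around the points [p - n * alpha]. *)
suff : open (torus_pi @^-1`
  [set x : torus R | torus_norm (iter n (rotation alpha) x) < r]) by [].
set A := _ @^-1` _.
have -> : A = \bigcup_(p in [set: int]) ball (p%:~R - n%:R * alpha : R) r.
  have ballE (y : R) (p : int) : ball (p%:~R - n%:R * alpha : R) r y =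
      (`|y + n%:R * alpha - p%:~R| < r) :> Prop.
    by rewrite /ball/= distrC opprB addrA.
  apply/seteqP; split => y; rewrite /A /= iter_rotation -torus_piD torus_normE.
    by move=> /dist_int_lt[p yp]; exists p => //; rewrite ballE.
  by move=> [p _]; rewrite ballE => yp; apply/dist_int_lt; exists p.
by apply: bigcup_open => p _; exact: ball_open.
Qed.

(** A representative in [[0, 1[] within [r] of an integer [p] lies below [r] if [p <= 0] and above
    [1 - r] if [p >= 1]. *)
Lemma haar_torus_norm_lt (R : realType) (r : R) : 0 <= r ->
  (haar [set x : torus R | (torus_norm x < r)%R] <= (2 * r)%:E)%E.
Proof.
move=> r0; rewrite haarE.
apply: le_trans (_ : lebesgue_measure (`[0%R, r[ `|` `](1 - r)%R, 1%R[) <= _)%E.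
  apply: le_measure; rewrite ?inE.
  - apply: measurableI => //; rewrite -[X in measurable X]setTI.
    (* The zeroth iterate is the identity, so this is the ball around [0]. *)
    by apply: measurable_torus_pi => //; exact: (@measurable_rotation_lt _ 0 r 0).
  - exact: measurableU.
  move=> y /= []; rewrite torus_normE dist_int_lt => -[p yp].
  rewrite !in_itv/= => /andP[y0 y1]; rewrite y0 y1 andbT/=.
  move: yp; rewrite ltr_norml => /andP[yp1 yp2].
  have [p0|p0] := leP p 0; [left|right].
    by move: p0; rewrite -(ler_int R) => p0; lra.
  by move: p0; rewrite gtz0_ge1 -(ler_int R) => p0; lra.
apply: (le_trans (measureU2 _ _ _)) => //.
rewrite /= !lebesgue_measure_itv/= !lte_fin.
by do 2 case: ifPn => _; rewrite -?EFinB -?EFinD ?adde0 ?add0e lee_fin; lra.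
Qed.

Lemma haar_rotation_lt (R : realType) (alpha r : R) (n : nat) : 0 <= r ->
  (haar [set x : torus R | (torus_norm (iter n (rotation alpha) x) < r)%R]
    <= (2 * r)%:E)%E.
Proof.
move=> r0; apply: le_trans (@haar_torus_norm_lt _ _ r0).
rewrite -(@haar_translate _ (torus_pi (n%:R * alpha)) [set x | torus_norm x < r]).
  rewrite le_eqVlt; apply/orP; left; apply/eqP; congr haar.
  by apply/seteqP; split => x /=; rewrite iter_rotation.
exact: (@measurable_rotation_lt _ 0 r 0).
Qed.

(* The union over a dyadic block has measure at most [2^k * 2 r^k], which is
   summable since [r < 1/2]. *)
Lemma ae_rotation_ge_dyadic (R : realType) (alpha r : R) : 0 < r < 2^-1 ->
  {ae @haar R, forall x : torus R, exists K : nat, forall k n : nat,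
    (K <= k)%N -> (2 ^ k <= n < 2 ^ k.+1)%N ->
    r ^+ k <= torus_norm (iter n (rotation alpha) x)}.
Proof.
move=> /andP[r0 r2].
pose E k n := [set x : torus R |
  torus_norm (iter n (rotation alpha) x) < r ^+ k].
pose F k := \big[setU/set0]_(i < 2 ^ k) E k (2 ^ k + i)%N.
have mF k : measurable (F k).
  by apply: bigsetU_measurable => i _; exact: measurable_rotation_lt.
have muF k : (haar (F k) <= (geometric 2 (2 * r) k)%:E)%E.
  have mE (i : nat) : (i < 2 ^ k)%N -> measurable (E k (2 ^ k + i)%N).
    by move=> _; exact: measurable_rotation_lt.
  apply: (le_trans (Boole_inequality haar mE)).
  apply: (@le_trans _ _ (\sum_(i < 2 ^ k) (2 * r ^+ k)%:E)%E).
    by apply: lee_sum => i _; apply: haar_rotation_lt; rewrite exprn_ge0// ltW.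
  rewrite sumEFin lee_fin sumr_const card_ord -[_ *+ (2 ^ k)]mulr_natr natrX.
  by rewrite /geometric/= exprMn -mulrA [r ^+ k * _]mulrC.
have F0 : haar (lim_sup_set F) = 0%E.
  apply: lim_sup_set_cvg0 => //.
  apply: (@le_lt_trans _ _ (2 / (1 - 2 * r))%:E); last exact: ltry.
  apply: lime_le; first exact: is_cvg_nneseries.
  apply: nearW => n.
  apply: (@le_trans _ _ (\sum_(0 <= k < n) (geometric 2 (2 * r) k)%:E)%E).
    by apply: lee_sum => k _; exact: muF.
  rewrite sumEFin lee_fin; apply: geometric_le_lim; [lra|lra|].
  by rewrite ger0_norm; lra.
have mS : measurable (lim_sup_set F).
  by apply: bigcapT_measurable => n; apply: bigcup_measurable.
(* A point for which no threshold [K] works lies in [F k] for arbitrarily large [k]. *)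
exists (lim_sup_set F); split => // x /= noK K _.
apply: contrapT => xF; apply: noK; exists K => k n Kk /andP[kn nk].
rewrite leNgt; apply/negP => xE; apply: xF; exists k => //.
have ik : (n - 2 ^ k < 2 ^ k)%N.
  by rewrite ltn_subLR// addnn -mul2n -expnS.
rewrite /F -(bigcup_mkord _ (fun i => E k (2 ^ k + i)%N)).
exists (n - 2 ^ k)%N => //.
by rewrite /E/= subnKC.
Qed.

(** * Bounds for limsups and logarithmic ratios *)

Lemma limn_esup_le (R : realType) (u : (\bar R)^nat) (M : \bar R) (N : nat) :
  (forall n, (N <= n)%N -> (u n <= M)%E) -> (limn_esup u <= M)%E.
Proof.
move=> uM; rewrite /limn_esup limf_esupE.
apply: (@le_trans _ _ (ereal_sup (u @` [set n | (N <= n)%N]))).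
  by apply: ereal_inf_lbound; exists [set n | (N <= n)%N] => //; exact: nbhs_infty_ge.
by apply: ge_ereal_sup => _ [n Nn <-]; exact: uM.
Qed.

Lemma limn_esup_ge (R : realType) (u : (\bar R)^nat) (M : \bar R) :
  (forall N, exists2 n, (N <= n)%N & (M <= u n)%E) -> (M <= limn_esup u)%E.
Proof.
move=> uM; rewrite /limn_esup limf_esupE; apply: le_ereal_inf_tmp.
move=> _ [V [N _ NV] <-]; have [n Nn Mn] := uM N.
by apply: le_trans Mn _; apply: ereal_sup_ubound; exists n => //; exact: NV.
Qed.

(* Equal to [+oo] when [d <= 0] and [1 < n], since [lne] is then [-oo]. *)
Definition log_ratio {R : realType} (d : R) (n : nat) : \bar R :=
  (- lne d%:E / lne (n%:R)%:E)%E.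

Lemma log_ratio_le (R : realType) (d c : R) (n : nat) : (1 < n)%N -> 0 < d ->
  - ln d <= c * ln n%:R -> (log_ratio d n <= c%:E)%E.
Proof.
move=> n1 d0 dc.
have ln0 : 0 < ln n%:R :> R by rewrite ln_gt0// ltr1n.
rewrite /log_ratio !lne_EFin ?ltr0n ?(ltnW n1)// inver gt_eqF// -EFinN.
by rewrite lee_pdivrMr// lee_fin.
Qed.

(** The positive majorant [b] is kept apart from [d] because [d] is [0] when the orbit hits the
    origin; the ratio is then [+oo]. *)
Lemma log_ratio_ge (R : realType) (d b c : R) (n : nat) : (1 < n)%N -> 0 < b ->
  d <= b -> c * ln n%:R <= - ln b -> (c%:E <= log_ratio d n)%E.
Proof.
move=> n1 b0 db cb.
have ln0 : 0 < ln n%:R :> R by rewrite ln_gt0// ltr1n.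
rewrite /log_ratio (@lne_EFin _ n%:R) ?ltr0n ?(ltnW n1)// inver gt_eqF//.
rewrite lee_pdivlMr// /lne; case: ifPn => [_|]; first by rewrite /= leey.
rewrite -ltNge => d0; rewrite -EFinN lee_fin; apply: le_trans cb _.
by rewrite lerN2 ler_ln ?posrE.
Qed.

(** * The lower and upper bounds for the limsup *)

Lemma limn_esup_log_ratio_ge1 (R : realType) (alpha : R) (x : torus R) :
  irrational alpha ->
  (1 <= limn_esup (fun n =>
    log_ratio (torus_norm (iter n (rotation alpha) x)) n))%E.
Proof.
move=> irr; apply/lee_subgt0Pr => e e0; apply: limn_esup_ge => N.
(* Beyond [expR (ln 6 / e)] one has [ln 6 <= e * ln n], hence [ln (n / 6) >= (1 - e) * ln n]. *)
pose M := maxn (maxn N 1) (Num.truncn (expR (ln 6 / e) : R)).+1.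
have [n [Mn nx]] := @inhomogeneous_approx _ alpha (repr x) M irr.
move: Mn; rewrite !gtn_max => /andP[/andP[Nn n1] en].
have nR0 : 0 < n%:R :> R by rewrite ltr0n ltnW.
exists n; first exact: ltnW.
apply: (@log_ratio_ge _ _ (6 / n%:R)) => //; first by rewrite divr_gt0.
  rewrite iter_rotation -[x]reprK -/(torus_pi (repr x)) -torus_piD torus_normE.
  by rewrite addrC.
rewrite ln_div ?posrE// opprB mulrBl mul1r lerD2l lerN2 mulrC -ler_pdivrMr//.
rewrite -ler_expR lnK ?posrE//.
apply/ltW; apply: lt_le_trans (truncnS_gt _) _.
by rewrite ler_nat ltnW.
Qed.

(** The radii [r m], equal to [2] to the power [- c m], increase to [1 / 2]. Being countably many,
    they share one null exceptional set, and [c m] bounds the limsup off it. *)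
Lemma ae_limn_esup_log_ratio_le1 (R : realType) (alpha : R) :
  {ae @haar R, forall x : torus R, (limn_esup (fun n =>
    log_ratio (torus_norm (iter n (rotation alpha) x)) n) <= 1)%E}.
Proof.
pose c (m : nat) : R := 1 + m.+1%:R^-1.
pose r m : R := expR (- (c m * ln 2)).
have l2 : 0 < ln 2 :> R by rewrite ln_gt0// ltr1n.
have c1 m : 1 < c m by rewrite ltrDl invr_gt0.
have r_lt m : 0 < r m < 2^-1.
  rewrite expR_gt0/= /r -[X in _ < X]lnK ?posrE// ltr_expR lnV ?posrE//.
  by rewrite ltrN2 ltr_pMl.
have /ae_foralln := fun m => @ae_rotation_ge_dyadic _ alpha (r m) (r_lt m).
apply: filterS => x Hx; apply/lee_addgt0Pr => e e0.
pose m := Num.truncn e^-1.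
have ce : c m <= 1 + e.
  rewrite lerD2l ltW// invf_plt ?posrE// truncnS_gt//.
have [K HK] := Hx m.
(* From this index on, the dyadic block number [k] of [n] is at least [K], and at least [1], so that
   [ln n > 0]. *)
apply: (@limn_esup_le _ _ _ (2 ^ maxn K 1)) => n Kn.
have n0 : (0 < n)%N by apply: leq_trans Kn; rewrite expn_gt0.
pose k := trunc_log 2 n.
have nk : (2 ^ k <= n < 2 ^ k.+1)%N by exact: trunc_log_bounds.
have kK : (maxn K 1 <= k)%N by exact: trunc_log_max.
move: kK; rewrite geq_max => /andP[Kk k1].
have rk := HK k n Kk nk.
have rk0 : 0 < r m ^+ k by rewrite exprn_gt0// expR_gt0.
have n1 : (1 < n)%N.
  case/andP: nk => + _; apply: leq_trans.
  by rewrite -[2%N in leqLHS]expn1 leq_pexp2l.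
apply: log_ratio_le => //; first exact: lt_le_trans rk.
apply: (@le_trans _ _ (- ln (r m ^+ k))).
  by rewrite lerN2 ler_ln ?posrE//; exact: lt_le_trans rk.
(* Here [- ln (r m ^+ k)] becomes [c m * ln (2 ^+ k)], and [2 ^ k <= n]. *)
rewrite lnXn ?expR_gt0// expRK -mulNrn opprK -mulrnAr -lnXn//.
apply: (@le_trans _ _ (c m * ln n%:R)).
  rewrite ler_pM2l; last exact: lt_trans (c1 m).
  by rewrite ler_ln ?posrE ?ltr0n// -natrX ler_nat; case/andP: nk.
by rewrite ler_wpM2r// ltW// ln_gt0// ltr1n.
Qed.

Theorem corollary1p7 (R : realType) (alpha : R) (halpha : irrational alpha) :
  {ae @haar R, forall x : torus R,
    limn_esup (fun n : nat =>
      - lne (torus_norm (iter n (rotation alpha) x))%:E / lne (n%:R)%:E)%E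
    = 1%E}.
Proof.
apply: filterS (ae_limn_esup_log_ratio_le1 _ alpha) => x ub.
apply/eqP; rewrite eq_le; apply/andP; split; first exact: ub.
exact: limn_esup_log_ratio_ge1.
Qed.
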